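(* Let $\alpha\in(0,1)$, let $J=[0,T]$ for some $T>0$ or $J=[0,\infty)$, and let $f:J\times\mathbb{R}\to\mathbb{R}$ be continuous and satisfy the Lipschitz condition: there is a continuous function $L:J\to[0,\infty)$ with $|f(t,x)-f(t,y)|\le L(t)|x-y|$ for all $t\in J$ and all $x,y\in\mathbb{R}$. Consider the one-dimensional fractional differential equation ${}^{C}D^\alpha_{0+}x(t)=f(t,x(t))$, $t\in J$. Then for any two initial values $x_{10}\neq x_{20}$ in $\mathbb{R}$, the solutions $x_1(\cdot),x_2(\cdot)$ with $x_1(0)=x_{10}$, $x_2(0)=x_{20}$ satisfy $x_1(t)\neq x_2(t)$ for all $t\in J$.
   Context: ${}^{C}D^\alpha_{0+}$ denotes the Caputo fractional derivative of order $\alpha\in(0,1)$: ${}^{C}D^\alpha_{0+}x(t)=\frac{1}{\Gamma(1-\alpha)}\int_0^t(t-\tau)^{-\alpha}x'(\tau)\,d\tau$. A solution is a continuous function $x:J\to\mathbb{R}$ satisfying the equation for all $0<t\in J$; equivalently, $x$ is continuous and $x(t)=x(0)+\frac{1}{\Gamma(\alpha)}\int_0^t(t-\tau)^{\alpha-1}f(\tau,x(\tau))\,d\tau$ for all $t\in J$. Under the stated Lipschitz condition, for each initial value there is a unique solution defined on all of $J$. *)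

(* Defs.v *)
From HB Require Import structures.
From mathcomp Require Import all_boot all_order all_algebra.
From mathcomp Require Import all_classical all_reals all_analysis.
Set Implicit Arguments. Unset Strict Implicit. Unset Printing Implicit Defensive.
Import Order.TTheory GRing.Theory Num.Theory.
Import numFieldNormedType.Exports.
Local Open Scope classical_set_scope.
Local Open Scope ring_scope.

Definition Gamma {R : realType} (a : R) : R :=
  fine (\int[@lebesgue_measure R]_(t in `]0%R, +oo[%classic)
          ((t `^ (a - 1)) * expR (- t))%:E)%E.

(* The time interval J = [0,T] (T finite, T > 0) or [0,oo) (T = +oo). *)
Definition Jset {R : realType} (T : \bar R) : set R :=
  [set t | (0 <= t)%R /\ (t%:E <= T)%E].

Definition rl_integrand {R : realType} (alpha : R) (f : R -> R -> R)
  (x : R -> R) (t : R) : R -> R :=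
  fun s => (t - s) `^ (alpha - 1) * f s (x s).

(* x : J -> R is a solution of  ^C D^alpha_{0+} x(t) = f(t, x(t))  on J:
   x is continuous on J and satisfies, for every t in J,
   x(t) = x(0) + 1/Gamma(alpha) \int_0^t (t-s)^(alpha-1) f(s,x(s)) ds,
   the integral existing as a Lebesgue integral. *)
Definition is_solution {R : realType} (alpha : R) (T : \bar R)
  (f : R -> R -> R) (x : R -> R) : Prop :=
  {within Jset T, continuous x} /\
  forall t, Jset T t ->
    (@lebesgue_measure R).-integrable `[0%R, t]%classic
        (EFin \o rl_integrand alpha f x t) /\
    x t = x 0 + (Gamma alpha)^-1 *
      Rintegral (@lebesgue_measure R) `[0%R, t]%classic (rl_integrand alpha f x t).

(* Main.v *)
Require Import Defs.
From HB Require Import structures.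
From mathcomp Require Import all_boot all_order all_algebra.
From mathcomp Require Import all_classical all_reals all_analysis.
From mathcomp Require Import measurable_realfun ring lra.
Set Implicit Arguments.
Unset Strict Implicit.
Unset Printing Implicit Defensive.
Import Order.TTheory GRing.Theory Num.Theory.
Import numFieldNormedType.Exports.
Local Open Scope classical_set_scope.
Local Open Scope ring_scope.

(** Let [u = x1 - x2], with [c = u 0 > 0], let [t0] be the first zero of [u], and
    put [g s = f s (x1 s) - f s (x2 s)], so that [u = c + I g / Gamma alpha] where
    [I g t = \int_0^t (t - s)^(alpha - 1) g s ds].  For [0 < d < t0], averaging
    [I g] at the times [t0 - d / q], [0 < q < 1], against the beta weight
    [(1 - q)^(- alpha) q^(alpha - 1)] of total mass [B] yields, by Fubini and an
    affine change of variable, exactly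
    [B * \int_0^(t0 - d) (t0 - s)^(alpha - 1) g s ds].
    As [u >= 0] on [[0, t0]], each [I g (t0 - d / q)] is at least
    [- c * Gamma alpha], and it vanishes when [q < d / t0]; hence [u t0] exceeds
    the contribution of [[t0 - d, t0]] by a gain of order [c * (d / t0)^alpha].
    The Lipschitz bound [|g| <= L u] and [u t0 = 0] make [g] vanish at [t0], so
    that contribution is [o(d^alpha)], and [u t0 > 0], a contradiction. *)

(** * Affine changes of variable in Lebesgue integrals *)

Section affine_substitution.
Context {R : realType}.
Notation mu := (@lebesgue_measure R).
Implicit Types (a b : R) (h : R -> \bar R).

Definition affine a b (x : measurableTypeR R) : measurableTypeR R := a * x + b.

Lemma measurable_affine a b : measurable_fun [set: measurableTypeR R] (affine a b).
Proof. by apply: measurable_funD => //; exact: measurable_funM. Qed.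

(** By uniqueness of Lebesgue measure, it is enough to compare the scaled pushforward with it on the
    intervals []c, d]]. *)
Lemma lebesgue_measure_affine a b (A : set R) : 0 < a -> measurable A ->
  (a%:E * mu (affine a b @^-1` A) = mu A)%E.
Proof.
move=> a0 mA.
rewrite [RHS](@lebesgue_measure_unique R
  (mscale (NngNum (ltW a0)) (pushforward mu (affine a b))))//=.
  exact: measurable_affine.
move=> ? _ [[c d]] _ <-.
rewrite /mscale/= -[pushforward _ _ _]/(mu (affine a b @^-1` _)).
have -> : affine a b @^-1` `]c, d] = `](c - b) / a, (d - b) / a]%classic.
  by apply/seteqP; split => x/=;
    rewrite !in_itv/= ltr_pdivrMr// ler_pdivlMr// (mulrC x) ltrBlDr lerBrDr.
rewrite !lebesgue_measure_itv/= !lte_fin ltr_pM2r ?invr_gt0// ltrD2r.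
case: ifPn => _; last by rewrite mule0.
by rewrite -EFinM; congr EFin; field; rewrite gt_eqF.
Qed.

Lemma ge0_integral_affine a b h : 0 < a ->
  measurable_fun [set: R] h -> (forall x, 0 <= h x)%E ->
  (\int[mu]_x h x = a%:E * \int[mu]_x h (a * x + b)%R)%E.
Proof.
move=> a0 mh h0; pose k := NngNum (ltW a0).
have hE : (\int[mu]_x h (a * x + b)%R = \int[pushforward mu (affine a b)]_x h x)%E.
  by rewrite (ge0_integral_pushforward (measurable_affine a b) mu measurableT mh).
rewrite hE.
rewrite -[a%:E]/(k%:num%:E) -ge0_integral_mscale//.
  exact: measurable_affine.
move=> ?; apply: eq_measure_integral => A mA _.
exact/esym/lebesgue_measure_affine.
Qed.

(** Slope [-1], excluded from [ge0_integral_affine]: a translation followed by invariance under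
    negation. *)
Lemma ge0_integral_reflection b h :
  measurable_fun [set: R] h -> (forall x, 0 <= h x)%E ->
  (\int[mu]_x h x = \int[mu]_x h (b - x)%R)%E.
Proof.
move=> mh h0.
rewrite (@ge0_integral_affine 1 b)// mul1e.
have mh1 : measurable_fun [set: R] (fun x => h (1 * x + b)).
  exact: measurableT_comp (measurable_affine 1 b).
transitivity (\int[mu]_(x in (-%R : _ -> measurableTypeR R) @^-1` [set: R])
    h (1 * - x + b)%R)%E; last first.
  by rewrite preimage_setT; apply: eq_integral => x _; rewrite mul1r addrC.
rewrite -[RHS](@ge0_integral_pushforward _ _ _ _ _
  (-%R : measurableTypeR R -> measurableTypeR R) _ mu setT
  (fun x => h (1 * x + b)))//=.
by apply: eq_measure_integral => //= A mA _; exact/esym/lebesgue_measureN.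
Qed.

End affine_substitution.

(** * Truncated powers and the integrability of powers near 0 *)

Section kpow.
Context {R : realType}.
Notation mu := (@lebesgue_measure R).
Implicit Types (a b x y : R).

(* The truncation matters: [powR] is 1, not 0, on negative numbers. *)
Definition kpow a x : R := if 0 < x then x `^ a else 0.

Lemma kpow_ge0 a x : 0 <= kpow a x.
Proof. by rewrite /kpow; case: ifP => // _; exact: powR_ge0. Qed.

Lemma kpow_le0 a x : x <= 0 -> kpow a x = 0.
Proof. by rewrite /kpow ltNge => ->. Qed.

Lemma kpow_gt0 a x : 0 < x -> kpow a x = x `^ a.
Proof. by rewrite /kpow => ->. Qed.

Lemma kpowM a x y : 0 < x -> kpow a (x * y) = x `^ a * kpow a y.
Proof.
move=> x0; rewrite /kpow pmulr_rgt0//; case: ifPn => y0; last by rewrite mulr0.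
by rewrite powRM// ltW.
Qed.

Lemma measurable_kpow a : measurable_fun [set: R] (kpow a).
Proof.
apply: measurable_fun_ifT => //.
exact: measurable_fun_ltr.
Qed.

(** The integral is 1 minus the power [a] of [e], so the bound is uniform in [e]; staying away from
    0 keeps the antiderivative differentiable. *)
Lemma integral_powR_segment a e : 0 < a -> 0 < e -> e < 1 ->
  (\int[mu]_(x in `[e, 1%R]) (a * x `^ (a - 1))%:E <= 1)%E.
Proof.
move=> a0 e0 e1.
have dF : forall x, 0 < x -> derivable (@powR R ^~ a) x 1.
  by move=> x x0; apply: derivable_powR; rewrite in_itv/= x0.
have cF : forall b x, 0 < x -> {for x, continuous (@powR R ^~ b)}.
  move=> b x x0; apply/differentiable_continuous/derivable1_diffP.
  by apply: derivable_powR; rewrite in_itv/= x0.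
rewrite (@continuous_FTC2 _ _ (@powR R ^~ a))//.
- by rewrite powR1 lee_fin lerBlDr lerDl powR_ge0.
- apply: continuous_in_subspaceT => x; rewrite inE/= in_itv/= => /andP[ex _].
  apply: cvgM; first exact: cvg_cst.
  by apply: cF; exact: lt_le_trans ex.
- split.
  + by move=> x; rewrite in_itv/= => /andP[ex _]; apply: dF; exact: lt_trans ex.
  + by apply: cvg_at_right_filter; exact: cF.
  + by apply: cvg_at_left_filter; exact: cF.
- move=> x; rewrite in_itv/= => /andP[ex _].
  by apply: powR_derive1; rewrite in_itv/= (lt_trans e0 ex).
Qed.

(** Monotone convergence along segments exhausting []0, 1]], each contributing at most [a^-1]. *)
Lemma integral_powR_lty a : 0 < a ->
  (\int[mu]_(x in `]0%R, 1%R]) (x `^ (a - 1))%:E < +oo)%E.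
Proof.
move=> a0.
have mp D : measurable_fun D (fun x : R => (x `^ (a - 1))%:E).
  by apply/measurable_EFinP; apply: measurable_funTS; exact: measurable_powR.
have p0 x : (0 <= (x `^ (a - 1))%:E)%E by rewrite lee_fin powR_ge0.
(* The shift by 2 keeps the left end strictly below 1, as [integral_powR_segment] requires. *)
pose F n : set (measurableTypeR R) := `[n.+2%:R^-1, 1%R]%classic.
have UF : `]0%R, 1%R]%classic = \bigcup_n F n.
  apply/seteqP; split => x/=.
    rewrite in_itv/= => /andP[x0 x1].
    have [n xn] := ltr_add_invr x0.
    exists n => //; rewrite /F/= in_itv/= x1 andbT.
    rewrite add0r in xn; apply: le_trans (ltW xn).
    by rewrite lef_pV2 ?posrE ?ltr0n// ler_nat.
  move=> [n _]; rewrite /F/= !in_itv/= => /andP[nx ->]; rewrite andbT.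
  by rewrite (lt_le_trans _ nx).
have Fnd : {homo F : n m / (n <= m)%N >-> (n <= m)%O}.
  move=> n m nm; apply/subsetPset => x; rewrite /F/= !in_itv/= => /andP[nx ->].
  rewrite andbT; apply: le_trans nx.
  by rewrite lef_pV2 ?posrE ?ltr0n// ler_nat.
have := @ge0_nondecreasing_set_cvg_integral _ _ _ F
  (fun x => (x `^ (a - 1))%:E) mu Fnd.
move=> /(_ (fun=> measurable_itv _) (fun=> mp _) (fun _ _ _ => p0 _)).
rewrite -UF => cvgF.
apply: (@le_lt_trans _ _ (a^-1)%:E); last exact: ltry.
rewrite -(cvg_lim _ cvgF)//.
apply: lime_le; first by apply/cvg_ex; eexists; exact: cvgF.
apply: nearW => n.
rewrite -(@lee_pmul2l _ a%:E)// -EFinM divff ?gt_eqF//.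
rewrite -ge0_integralZl//=.
- by apply: integral_powR_segment => //; rewrite invf_lt1// ltr1n.
- exact: measurable_itv.
- exact: mp.
- exact: ltW.
Qed.

End kpow.

(** * Euler's beta integral: scaling, finiteness, lower bound *)

Section beta.
Context {R : realType}.
Notation mu := (@lebesgue_measure R).
Implicit Types (a b x y : R).

(** The arguments are the exponents themselves: this is the classical beta function at
    [(a + 1, b + 1)]. *)
Definition Beta a b : \bar R := (\int[mu]_x (kpow a (1 - x) * kpow b x)%:E)%E.

Lemma measurable_kpowB a b : measurable_fun [set: R] (fun x => kpow a (b - x)).
Proof.
by apply: measurableT_comp; [exact: measurable_kpow|exact: measurable_funB].
Qed.

Lemma measurable_kpowD a b : measurable_fun [set: R] (fun x => kpow a (x - b)).
Proof.
by apply: measurableT_comp; [exact: measurable_kpow|exact: measurable_funB].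
Qed.

(** Exponent 0 encodes a sharp cutoff, so truncated kernels fall under the same convolution
    formulas. *)
Lemma kpow0 x : kpow 0 x = (0 < x)%R%:R.
Proof. by rewrite /kpow powRr0; case: ifP. Qed.

(** The affine map from []0, 1[] onto []p, d[] brings out exponents [a] and [b] from the two factors
    and 1 from the Jacobian. *)
Lemma kpow_convolution a b p d : p < d ->
  (\int[mu]_x (kpow a (d - x) * kpow b (x - p))%:E =
   ((d - p) `^ (a + b + 1))%:E * Beta a b)%E.
Proof.
move=> pd; have dp : 0 < d - p by rewrite subr_gt0.
have dp0 : d - p != 0 by rewrite gt_eqF.
rewrite [LHS](@ge0_integral_affine _ (d - p) p _ dp); first last.
- by move=> x; rewrite lee_fin mulr_ge0 ?kpow_ge0.
- apply/measurable_EFinP/measurable_funM; first exact: measurable_kpowB.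
  exact: measurable_kpowD.
under eq_integral => x _.
  rewrite (_ : d - ((d - p) * x + p) = (d - p) * (1 - x)); last first.
    by rewrite mulrBr mulr1 opprD addrA addrAC.
  rewrite addrK.
  rewrite !kpowM// mulrACA EFinM.
  over.
rewrite ge0_integralZl//=.
- rewrite muleA; congr (_ * _)%E.
  by rewrite -EFinM powRD ?dp0 ?implybT// powRD ?dp0 ?implybT// powRr1 ?ltW// mulrC.
- apply/measurable_EFinP/measurable_funM; first exact: measurable_kpowB.
  exact: measurable_kpow.
- by move=> x _; rewrite lee_fin mulr_ge0 ?kpow_ge0.
- by rewrite lee_fin mulr_ge0 ?powR_ge0.
Qed.

Lemma kpow_convolution0 a b p d : d <= p ->
  (\int[mu]_x (kpow a (d - x) * kpow b (x - p))%:E = 0)%E.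
Proof.
move=> dp; apply: integral0_eq => x _.
have [xd|dx] := leP x p; first by rewrite (kpow_le0 b)// ?mulr0// subr_le0.
by rewrite kpow_le0 ?mul0r// subr_le0 (le_trans dp)// ltW.
Qed.

Lemma Beta_ge0 a b : (0 <= Beta a b)%E.
Proof. by apply: integral_ge0 => x _; rewrite lee_fin mulr_ge0 ?kpow_ge0. Qed.

Lemma Beta0_lty b : -1 < b -> (Beta 0 b < +oo)%E.
Proof.
move=> b1; have b0 : 0 < b + 1 by lra.
apply: (le_lt_trans _ (integral_powR_lty b0)).
rewrite [leRHS]integral_mkcond addrK.
apply: ge0_le_integral => //.
- by move=> x _; rewrite lee_fin mulr_ge0 ?kpow_ge0.
- apply/measurable_EFinP/measurable_funM; first exact: measurable_kpowB.
  exact: measurable_kpow.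
- apply/measurable_restrict => //; rewrite setTI.
  by apply/measurable_EFinP; apply: measurable_funTS; exact: measurable_powR.
- move=> x _; rewrite patchE; case: ifPn => [_|].
    rewrite lee_fin kpow0 /kpow; case: ifP => _; last by rewrite mulr0 powR_ge0.
    by case: ltP => _; rewrite ?mul1r// mul0r powR_ge0.
  rewrite notin_setE/= in_itv/= => /negP; rewrite negb_and -!leNgt -ltNge.
  move=> /orP[x0|x1]; first by rewrite [kpow b x]kpow_le0// mulr0.
  by rewrite kpow_le0 ?mul0r// subr_le0 ltW.
Qed.

Lemma Beta_sym a b : Beta a b = Beta b a.
Proof.
rewrite /Beta [LHS](@ge0_integral_reflection _ 1).
- by apply: eq_integral => x _; rewrite subKr mulrC.
- apply/measurable_EFinP/measurable_funM; first exact: measurable_kpowB.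
  exact: measurable_kpow.
- by move=> x; rewrite lee_fin mulr_ge0 ?kpow_ge0.
Qed.

Lemma le_powR_neg a x y : a <= 0 -> 0 < x -> x <= y -> y `^ a <= x `^ a.
Proof.
move=> a0 x0 xy; rewrite /powR !gt_eqF ?(lt_le_trans x0)// ler_expR.
by rewrite ler_wnM2l// ler_ln// posrE (lt_le_trans x0).
Qed.

(** Split at [2^-1]: on each half the factor without singularity is at most its value there, which
    leaves a beta integral with one exponent 0. *)
Lemma Beta_lty a b : -1 < a <= 0 -> -1 < b <= 0 -> (Beta a b < +oo)%E.
Proof.
move=> /andP[a1 a0] /andP[b1 b0].
pose Ca := (2^-1 : R) `^ a; pose Cb := (2^-1 : R) `^ b.
have Ca0 : 0 <= Ca by exact: powR_ge0.
have Cb0 : 0 <= Cb by exact: powR_ge0.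
have m1 : measurable_fun [set: R] (fun x => (kpow 0 (1 - x) * kpow b x)%:E).
  apply/measurable_EFinP/measurable_funM; first exact: measurable_kpowB.
  exact: measurable_kpow.
have m2 : measurable_fun [set: R] (fun x => (kpow a (1 - x) * kpow 0 x)%:E).
  apply/measurable_EFinP/measurable_funM; first exact: measurable_kpowB.
  exact: measurable_kpow.
apply: (@le_lt_trans _ _ (Ca%:E * Beta 0 b + Cb%:E * Beta a 0)%E); last first.
  rewrite (Beta_sym a 0).
  have [x ->] : exists x, Beta 0 a = x%:E.
    exists (fine (Beta 0 a)); rewrite fineK// ge0_fin_numE ?Beta0_lty//.
    exact: Beta_ge0.
  have [y ->] : exists x, Beta 0 b = x%:E.
    exists (fine (Beta 0 b)); rewrite fineK// ge0_fin_numE ?Beta0_lty//.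
    exact: Beta_ge0.
  by rewrite -!EFinM -EFinD ltry.
rewrite /Beta -!ge0_integralZl//=; first last.
- by move=> x _; rewrite lee_fin mulr_ge0 ?kpow_ge0.
- by move=> x _; rewrite lee_fin mulr_ge0 ?kpow_ge0.
rewrite -ge0_integralD//=; first last.
- exact: measurable_funeM.
- by move=> x _; rewrite -EFinM lee_fin !mulr_ge0 ?kpow_ge0.
- exact: measurable_funeM.
- by move=> x _; rewrite -EFinM lee_fin !mulr_ge0 ?kpow_ge0.
apply: ge0_le_integral => //.
- by move=> x _; rewrite lee_fin mulr_ge0 ?kpow_ge0.
- apply/measurable_EFinP/measurable_funM; first exact: measurable_kpowB.
  exact: measurable_kpow.
- by apply: emeasurable_funD; exact: measurable_funeM.
move=> x _; rewrite -!EFinM -EFinD lee_fin.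
have t1 : 0 <= Ca * (kpow 0 (1 - x) * kpow b x) by rewrite !mulr_ge0 ?kpow_ge0.
have t2 : 0 <= Cb * (kpow a (1 - x) * kpow 0 x) by rewrite !mulr_ge0 ?kpow_ge0.
have [x0|x0] := leP x 0.
  by rewrite [leLHS](_ : _ = 0) ?addr_ge0// (kpow_le0 b)// mulr0.
have [x1|x1] := leP 1 x.
  by rewrite [leLHS](_ : _ = 0) ?addr_ge0// (kpow_le0 a) ?subr_le0// mul0r.
have x1' : 0 < 1 - x by rewrite subr_gt0.
have [xh|xh] := leP x 2^-1.
  apply: ler_wpDr => //.
  rewrite !kpow0 x1' mul1r ler_wpM2r ?kpow_ge0// kpow_gt0//.
  by apply: le_powR_neg => //; lra.
apply: ler_wpDl => //.
rewrite !kpow0 x0 mulr1 mulrC ler_wpM2r ?kpow_ge0// kpow_gt0//.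
by apply: le_powR_neg => //; lra.
Qed.

Lemma Beta0_ge1 b : b <= 0 -> (1 <= Beta 0 b)%E.
Proof.
move=> b0; apply: (@le_trans _ _ (mu `]0%R, 1%R[)).
  by rewrite lebesgue_measure_itv/= lte_fin ltr01 oppr0 adde0.
rewrite -[leLHS]mul1e -integral_cst//= integral_mkcond.
apply: ge0_le_integral => //.
- by move=> x _; rewrite patchE; case: ifP.
- exact/measurable_restrict.
- apply/measurable_EFinP/measurable_funM; first exact: measurable_kpowB.
  exact: measurable_kpow.
move=> x _; rewrite patchE; case: ifPn; last first.
  by move=> _; rewrite lee_fin mulr_ge0 ?kpow_ge0.
rewrite inE/= in_itv/= => /andP[x0 x1].
rewrite lee_fin kpow0 subr_gt0 x1 mul1r kpow_gt0//.
have := @le_powR_neg b x 1 b0 x0 (ltW x1).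
by rewrite powR1.
Qed.

End beta.

(** * Integrability of products of truncated powers *)

Section integrable.
Context {R : realType}.
Notation mu := (@lebesgue_measure R).

Lemma ge0_integrable (h : R -> R) : measurable_fun [set: R] h ->
  (forall x, 0 <= h x) -> (\int[mu]_x (h x)%:E < +oo)%E ->
  mu.-integrable [set: R] (EFin \o h).
Proof.
move=> mh h0 hoo; apply/integrableP; split; first exact/measurable_EFinP.
by under eq_integral do rewrite /= ger0_norm//.
Qed.

Lemma dominated_integrable (f h : R -> R) : measurable_fun [set: R] f ->
  (forall x, `|f x| <= h x) -> mu.-integrable [set: R] (EFin \o h) ->
  mu.-integrable [set: R] (EFin \o f).
Proof.
move=> mf fh; apply: le_integrable => //; first exact/measurable_EFinP.
by move=> x _ /=; rewrite lee_fin (le_trans (fh x))// ler_norm.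
Qed.

Lemma integrable_kpow_convolution (a b p d : R) : -1 < a <= 0 -> -1 < b <= 0 ->
  mu.-integrable [set: R] (EFin \o (fun x => kpow a (d - x) * kpow b (x - p))).
Proof.
move=> a1 b1; apply: ge0_integrable.
- by apply: measurable_funM; [exact: measurable_kpowB|exact: measurable_kpowD].
- by move=> x; rewrite mulr_ge0 ?kpow_ge0.
have [pd|dp] := ltP p d; last by rewrite kpow_convolution0.
rewrite kpow_convolution// -(@fineK _ (Beta a b)); first by rewrite -EFinM ltry.
by rewrite ge0_fin_numE ?Beta_lty ?Beta_ge0.
Qed.

Lemma Rintegral_kpow_convolution (a b p d : R) :
  -1 < a <= 0 -> -1 < b <= 0 -> p < d ->
  \int[mu]_x (kpow a (d - x) * kpow b (x - p)) =
    (d - p) `^ (a + b + 1) * fine (Beta a b).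
Proof.
move=> a1 b1 pd; rewrite /Rintegral kpow_convolution// fineM//.
by rewrite ge0_fin_numE ?Beta_lty ?Beta_ge0.
Qed.

End integrable.

(** * Averaging the fractional integral by Fubini *)

Section fractional_integral.
Context {R : realType}.
Notation mu := (@lebesgue_measure R).
Variables (al t0 M : R) (g : R -> R).
Hypothesis al01 : 0 < al < 1.
Hypothesis mg : measurable_fun [set: R] g.
Hypothesis gM : forall s, `|g s| <= M.
Hypothesis g_lt0 : forall s : R, s < 0 -> g s = 0.
Hypothesis g_get0 : forall s, t0 <= s -> g s = 0.

Local Notation k := (kpow (al - 1)).
Local Notation l := (kpow (- al)).
Local Notation B := (fine (Beta (- al) (al - 1))).

(* The Riemann-Liouville integral of [g] without its factor [(Gamma al)^-1]. *)
Definition frac_int (t : R) : R := \int[mu]_s (k (t - s) * g s).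

Let kr : -1 < al - 1 <= 0. Proof. by move: al01 => /andP[]; lra. Qed.
Let lr : -1 < - al <= 0. Proof. by move: al01 => /andP[]; lra. Qed.
Let zr : -1 < (0 : R) <= 0. Proof. by lra. Qed.
Let B0 : 0 <= B. Proof. by rewrite fine_ge0// Beta_ge0. Qed.
Let M0 : 0 <= M. Proof. exact: le_trans (gM 0). Qed.

Let BE : Beta (- al) (al - 1) = B%:E.
Proof. by rewrite fineK// ge0_fin_numE ?Beta_lty ?Beta_ge0. Qed.

Lemma integrable_frac_int t (w : R -> R) : measurable_fun [set: R] w ->
  (forall s, 0 <= w s <= 1) ->
  mu.-integrable [set: R] (EFin \o (fun s => k (t - s) * w s * g s)).
Proof.
move=> mw w01.
(* The cutoff sits at [-1] because it is strict: placed at 0 it would vanish at [s = 0], where [g]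
   may not. *)
apply: (@dominated_integrable _ _ (fun s => M * (k (t - s) * kpow 0 (s - (-1))))).
- apply: measurable_funM => //; apply: measurable_funM => //.
  exact: measurable_kpowB.
- move=> s; rewrite kpow0; have [s0|s0] := ltP s 0.
    by rewrite g_lt0// mulr0 normr0 !mulr_ge0 ?kpow_ge0.
  rewrite (_ : (0 < _)%R = true) ?mulr1; last by lra.
  rewrite normrM mulrC ler_pM// normrM ger0_norm ?kpow_ge0//.
  have /andP[w0 w1] := w01 s.
  by rewrite ger0_norm// ler_piMr// kpow_ge0.
- under [X in _.-integrable _ X]eq_fun do rewrite /= EFinM.
  by apply: integrableZl => //; exact: integrable_kpow_convolution.
Qed.

Lemma integrable_frac_int1 t :
  mu.-integrable [set: R] (EFin \o (fun s => k (t - s) * g s)).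
Proof.
rewrite (_ : (fun s => _) = (fun s => k (t - s) * 1 * g s)); last first.
  by apply/funext => s; rewrite mulr1.
by apply: (@integrable_frac_int _ (cst 1)) => // s; rewrite ler01 lexx.
Qed.

Lemma integrable_frac_int_trunc (r : R) : mu.-integrable [set: R]
  (EFin \o (fun s => k (t0 - s) * kpow 0 (r - s) * g s)).
Proof.
apply: integrable_frac_int; first exact: measurable_kpowB.
by move=> s; rewrite kpow0 ler0n lern1 leq_b1.
Qed.

(** For [q > 0], the argument [q * (t0 - s) - d] is [q * (t0 - d / q - s)]: the kernel at time
    [t0 - d / q], with the factor [k q] absorbed and no division. *)
Let F (d : R) (z : R * R) : R := l (1 - z.1) * k (z.1 * (t0 - z.2) - d) * g z.2.

Let mF d : measurable_fun [set: R * R] (F d).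
Proof.
apply: measurable_funM; last exact: measurableT_comp.
apply: measurable_funM.
  by apply: (measurableT_comp (measurable_kpowB _ _)).
apply: (measurableT_comp (measurable_kpow _)).
by apply: measurable_funB => //; apply: measurable_funM => //; apply: measurable_funB.
Qed.

(* The substitution [q |-> (q - p) / (1 - p)] with [p = d / (t0 - s)] turns the
   left-hand side into an Euler integral that no longer depends on [s]. *)
Lemma integral_kpow_rescaled (d s : R) : 0 < d -> s < t0 ->
  (\int[mu]_q (l (1 - q) * k (q * (t0 - s) - d))%:E =
   (B * (k (t0 - s) * kpow 0 (t0 - d - s)))%:E)%E.
Proof.
move=> d0 st; have ts : 0 < t0 - s by rewrite subr_gt0.
under eq_integral => q _.
  rewrite (_ : q * (t0 - s) - d = (t0 - s) * (q - d / (t0 - s))); last first.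
    by rewrite [RHS]mulrBr mulrC; congr (_ - _); rewrite mulrCA divff ?mulr1 ?gt_eqF.
  rewrite [k _]kpowM// mulrCA EFinM.
  over.
rewrite ge0_integralZl//=; first last.
- by rewrite lee_fin powR_ge0.
- by move=> q _; rewrite lee_fin mulr_ge0 ?kpow_ge0.
- apply/measurable_EFinP/measurable_funM; first exact: measurable_kpowB.
  exact: measurable_kpowD.
rewrite [k _]kpow_gt0// kpow0 addrAC subr_gt0.
have [dts|dts] := ltP d (t0 - s).
  rewrite kpow_convolution; last by rewrite ltr_pdivrMr// mul1r.
  (* The exponents [- al] and [al - 1] sum to [-1], so the length [1 - p] gets exponent 0. *)
  by rewrite addrA addNr sub0r addNr powRr0 mul1e BE -EFinM mulr1 mulrC.
rewrite kpow_convolution0; last by rewrite ler_pdivlMr// mul1r.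
by rewrite mule0 mulr0 mulr0.
Qed.

Let intF2 (d s : R) : 0 < d ->
  (\int[mu]_q (F d (q, s))%:E =
   (B * (k (t0 - s) * kpow 0 (t0 - d - s) * g s))%:E)%E.
Proof.
move=> d0; rewrite /F/=; have [st|st] := ltP s t0; last first.
  by rewrite g_get0// !mulr0; apply: integral0_eq => q _; rewrite mulr0.
under eq_integral do rewrite mulrC EFinM.
rewrite integralZl//=; last first.
  apply: ge0_integrable.
  - apply: measurable_funM; first exact: measurable_kpowB.
    apply: (measurableT_comp (measurable_kpow _)).
    by apply: measurable_funB => //; exact: measurable_funM.
  - by move=> x; rewrite mulr_ge0 ?kpow_ge0.
  - by rewrite integral_kpow_rescaled// ltry.
rewrite integral_kpow_rescaled// -EFinM; congr EFin.
by rewrite [LHS]mulrCA [g s * _]mulrC.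
Qed.

(** Absolute-value version of [intF2], for the Tonelli criterion in [integrableF]. *)
Let intFabs2 (d s : R) : 0 < d ->
  (\int[mu]_q `|(F d (q, s))%:E| =
   (B * (k (t0 - s) * kpow 0 (t0 - d - s) * `|g s|))%:E)%E.
Proof.
move=> d0; rewrite /F/=; have [st|st] := ltP s t0; last first.
  rewrite g_get0// normr0 !mulr0; apply: integral0_eq => q _.
  by rewrite mulr0 normr0.
under eq_integral do rewrite normrM ger0_norm ?mulr_ge0 ?kpow_ge0// mulrC EFinM.
rewrite ge0_integralZl//=; first last.
- by move=> q _; rewrite lee_fin mulr_ge0 ?kpow_ge0.
- apply/measurable_EFinP/measurable_funM; first exact: measurable_kpowB.
  apply: (measurableT_comp (measurable_kpow _)).
  by apply: measurable_funB => //; exact: measurable_funM.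
rewrite integral_kpow_rescaled// -EFinM; congr EFin.
by rewrite [LHS]mulrCA [`|_| * _]mulrC.
Qed.

Let intF1 (d q : R) : 0 < d ->
  (\int[mu]_s (F d (q, s))%:E = (l (1 - q) * k q * frac_int (t0 - d / q))%:E)%E.
Proof.
move=> d0; rewrite /F/=; have [q0|q0] := leP q 0.
  (* Here [t0 - d / q] is meaningless as an averaging time, but both sides vanish: for [s < t0] the
     argument of the kernel is negative. *)
  rewrite [k q]kpow_le0// mulr0 mul0r; apply: integral0_eq => s _.
  have [st|st] := ltP s t0; last by rewrite g_get0// mulr0.
  rewrite [k _]kpow_le0 ?mulr0 ?mul0r//.
  have : q * (t0 - s) <= 0 by rewrite mulr_le0_ge0// subr_ge0 ltW.
  by lra.
under eq_integral => s _.
  rewrite (_ : q * (t0 - s) - d = q * (t0 - d / q - s)); last first.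
    by rewrite addrAC [RHS]mulrBr; congr (_ - _); rewrite mulrCA divff ?mulr1 ?gt_eqF.
  rewrite [k _]kpowM// -[q `^ _](@kpow_gt0 _ _ q)// mulrA -mulrA EFinM.
  over.
have ik := @integrable_frac_int1 (t0 - d / q).
rewrite integralZl// [RHS]EFinM; congr (_ * _)%E.
rewrite /frac_int /Rintegral fineK//.
exact: integrable_fin_num.
Qed.

Let integrableF (d : R) : 0 < d ->
  (mu \x mu)%E.-integrable [set: R * R] (EFin \o F d).
Proof.
move=> d0; apply/integrable21ltyP.
  have /measurable_EFinP := @mF d; exact.
under eq_integral do rewrite intFabs2//.
have /integrableP[_] := integrable_frac_int_trunc (t0 - d).
(* Multiplying a strict bound needs a positive factor; [B0] gives only [0 <= B], hence [B + 1]. *)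
rewrite -(@lte_pmul2l _ (B + 1)%:E)//; last by rewrite lte_fin ltr_wpDl.
rewrite mulry gtr0_sg ?ltr_wpDl// mul1e; apply: le_lt_trans.
rewrite -ge0_integralZl//=; first last.
- by rewrite lee_fin addr_ge0.
- apply/measurable_EFinP; apply: measurableT_comp => //; apply: measurable_funM => //.
  by apply: measurable_funM; exact: measurable_kpowB.
apply: ge0_le_integral => //=.
- by move=> s _; rewrite lee_fin !mulr_ge0 ?kpow_ge0.
- apply/measurable_EFinP; apply: measurable_funM => //; apply: measurable_funM.
    by apply: measurable_funM; exact: measurable_kpowB.
  exact: measurableT_comp.
- apply: measurable_funeM; apply/measurable_EFinP; apply: measurableT_comp => //.
  apply: measurable_funM => //.
  by apply: measurable_funM; exact: measurable_kpowB.
- move=> s _; rewrite -EFinM lee_fin !normrM !(ger0_norm (kpow_ge0 _ _)).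
  by rewrite ler_wpM2r ?lerDl// !mulr_ge0 ?kpow_ge0.
Qed.

(** The two sides are the iterated integrals of [F d], over [s] first and over [q] first. The
    integrability is kept for the later comparison of integrals. *)
Lemma frac_int_balayage (d : R) : 0 < d ->
  mu.-integrable [set: R]
    (EFin \o (fun q => l (1 - q) * k q * frac_int (t0 - d / q))) /\
  \int[mu]_q (l (1 - q) * k q * frac_int (t0 - d / q)) =
    B * \int[mu]_s (k (t0 - s) * kpow 0 (t0 - d - s) * g s).
Proof.
move=> d0; have iF := integrableF d0.
have FE : fubini_F mu (EFin \o F d) =
    EFin \o (fun q => l (1 - q) * k q * frac_int (t0 - d / q)).
  by apply/funext => q; exact: intF1.
have ig := integrable_frac_int_trunc (t0 - d).
split; first by rewrite -FE; exact: integrable_fubini_F.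
rewrite -RintegralZl//; congr fine.
transitivity (\int[mu]_q \int[mu]_s (EFin \o F d) (q, s))%E.
  by apply: eq_integral => q _; rewrite -intF1.
rewrite Fubini//; apply: eq_integral => s _.
exact: intF2.
Qed.

End fractional_integral.

(** * Strict positivity at the endpoint [t0] *)

Section positivity.
Context {R : realType}.
Notation mu := (@lebesgue_measure R).
Variables (al t0 M : R) (g : R -> R).
Hypothesis al01 : 0 < al < 1.
Hypothesis mg : measurable_fun [set: R] g.
Hypothesis gM : forall s, `|g s| <= M.
Hypothesis g_lt0 : forall s : R, s < 0 -> g s = 0.
Hypothesis g_get0 : forall s, t0 <= s -> g s = 0.

Local Notation k := (kpow (al - 1)).
Local Notation l := (kpow (- al)).
Local Notation B := (fine (Beta (- al) (al - 1))).
Local Notation P := (fine (Beta 0 (al - 1))).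

Local Notation Ig := (frac_int al g).

Let kr : -1 < al - 1 <= 0. Proof. by move: al01 => /andP[]; lra. Qed.
Let lr : -1 < - al <= 0. Proof. by move: al01 => /andP[]; lra. Qed.
Let zr : -1 < (0 : R) <= 0. Proof. by lra. Qed.
Let B0 : 0 <= B. Proof. by rewrite fine_ge0// Beta_ge0. Qed.

Let P1 : 1 <= P.
Proof.
rewrite -lee_fin fineK; first by apply: Beta0_ge1; case/andP: kr.
by rewrite ge0_fin_numE ?Beta_lty ?Beta_ge0.
Qed.

Let l_ge1 (q : R) : 0 < q -> q < 1 -> 1 <= l (1 - q).
Proof.
move=> q0 q1; rewrite kpow_gt0 ?subr_gt0//.
have := @le_powR_neg _ (- al) (1 - q) 1; rewrite powR1; apply; last by lra.
- by case/andP: lr.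
- by rewrite subr_gt0.
Qed.

(** For [d / t0 <= q < 1] the time [t0 - d / q] lies in [[0, t0]] and the sign hypothesis applies;
    for smaller positive [q] it is negative and [Ig] vanishes. Subtracting [k q] instead of
    [l (1 - q) * k q] is allowed by [l_ge1] and leaves an explicit integral. *)
Lemma frac_int_weight_ge (c ka d q : R) : 0 < c -> 0 < d -> d < t0 ->
  (forall t : R, 0 <= t <= t0 -> 0 <= c + ka * Ig t) ->
  - c * (l (1 - q) * k (q - 0) - kpow 0 (d / t0 - q) * k (q - 0)) <=
  ka * (l (1 - q) * k q * Ig (t0 - d / q)).
Proof.
move=> c0 d0 dt0 u0; rewrite subr0.
have t00 : 0 < t0 by exact: lt_trans dt0.
have p1 : d / t0 < 1 by rewrite ltr_pdivrMr// mul1r.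
have [q0|q0] := leP q 0.
  by rewrite [k q]kpow_le0// !mulr0 subrr mul0r !mulr0.
have [q1|q1] := leP 1 q.
  rewrite [l _]kpow_le0 ?subr_le0// [kpow 0 _]kpow_le0; last by lra.
  by rewrite !mul0r subrr !mulr0.
have k0 : 0 <= k q by exact: kpow_ge0.
have l1 := l_ge1 q0 q1.
have [pq|qp] := leP (d / t0) q.
  rewrite [kpow 0 _]kpow_le0 ?subr_le0// mul0r subr0.
  have dq : d / q <= t0 by rewrite ler_pdivrMr// mulrC -ler_pdivrMr.
  have dq0 : 0 < d / q by rewrite divr_gt0.
  have := u0 (t0 - d / q); rewrite subr_ge0 dq gerBl ltW// => /(_ isT) h.
  have := mulr_ge0 (mulr_ge0 (le_trans ler01 l1) k0) h.
  by lra.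
rewrite kpow0 subr_gt0 qp -mulrBl.
have -> : Ig (t0 - d / q) = 0.
  rewrite /frac_int /Rintegral integral0_eq// => s _.
  have [s0|s0] := ltP s 0; first by rewrite g_lt0// mulr0.
  have dq : t0 < d / q by rewrite ltr_pdivlMr// mulrC -ltr_pdivlMr.
  by rewrite [k _]kpow_le0 ?mul0r//; lra.
by rewrite !mulr0 mulNr oppr_le0 mulr_ge0 ?mulr_ge0 ?subr_ge0// ltW.
Qed.

(* If [c + ka * Ig] is nonnegative on [0, t0], then so is the weighted
   average of its values at the times [t0 - d / q]; the mass of the weight that
   falls on negative times leaves a gain of order [d `^ al]. *)
Lemma frac_int_trunc_ge (c ka d : R) : 0 < c -> 0 < d -> d < t0 ->
  (forall t : R, 0 <= t <= t0 -> 0 <= c + ka * Ig t) ->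
  - c * (B - (d / t0) `^ al * P) <=
  ka * (B * \int[mu]_s (k (t0 - s) * kpow 0 (t0 - d - s) * g s)).
Proof.
move=> c0 d0 dt0 u0.
have [iH <-] := frac_int_balayage al01 mg gM g_lt0 g_get0 d0.
have t00 : 0 < t0 by exact: lt_trans dt0.
have p0 : 0 < d / t0 by rewrite divr_gt0.
have iW1 := @integrable_kpow_convolution R (- al) (al - 1) 0 1 lr kr.
have iW2 := @integrable_kpow_convolution R 0 (al - 1) 0 (d / t0) zr kr.
have iW := integrableB measurableT iW1 iW2.
apply: (@le_trans _ _ (\int[mu]_q
    (- c * (l (1 - q) * k (q - 0) - kpow 0 (d / t0 - q) * k (q - 0))))).
  (* The masses are [B], on an interval of length 1, and [P] times the power [0 + (al - 1) + 1 = al]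
     of [d / t0]. *)
  rewrite RintegralZl// RintegralB// !Rintegral_kpow_convolution//.
  rewrite !subr0 add0r subrK powR1 mul1r.
  exact: lexx.
rewrite -RintegralZl//; apply: le_Rintegral => //.
- exact: (integrableZl measurableT (- c) iW).
- exact: (integrableZl measurableT ka iH).
- by move=> q _; exact: frac_int_weight_ge.
Qed.

(** Only [s] in [[t0 - d, t0[] contributes. The window [V] has width [2 * d] so that its strict
    cutoff still includes [s = t0 - d]. *)
Lemma frac_int_tail (d e : R) : 0 < d -> 0 <= e ->
  (forall s, t0 - d *+ 2 < s -> `|g s| <= e) ->
  `|\int[mu]_s (k (t0 - s) * g s) -
    \int[mu]_s (k (t0 - s) * kpow 0 (t0 - d - s) * g s)| <= e * (2 * d `^ al * P).
Proof.
move=> d0 e0 ge; pose V s := k (t0 - s) * kpow 0 (s - (t0 - d *+ 2)).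
have iV : mu.-integrable [set: R] (EFin \o V) by exact: integrable_kpow_convolution.
have j1 := integrable_frac_int1 al01 mg gM g_lt0 t0.
have j2 := integrable_frac_int_trunc t0 al01 mg gM g_lt0 (t0 - d).
have i1 := integrableB measurableT j1 j2.
rewrite -RintegralB//.
apply: le_trans (le_normr_Rintegral measurableT i1) _.
apply: (@le_trans _ _ (\int[mu]_s (e * V s))); last first.
  rewrite RintegralZl// ler_wpM2l// /V Rintegral_kpow_convolution//; last by lra.
  rewrite addr0 subrK (_ : t0 - _ = 2 * d); last by lra.
  rewrite Beta_sym ler_wpM2r ?(le_trans ler01)// powRM// ?(ltW d0)//.
  rewrite ler_wpM2r ?powR_ge0//.
  (* As [al < 1], the power [al] of 2 is at most 2. *)
  have /andP[_ a1] := al01.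
  by rewrite (le_trans (ler_powR _ (ltW a1)))// ?powRr1//; lra.
apply: le_Rintegral => //.
- exact: integrable_norm i1.
- rewrite (_ : _ \o _ = fun q => (e%:E * (EFin \o V) q)%E); first exact: integrableZl.
  by apply/funext => q.
move=> s _; rewrite /V kpow0.
have k0 : 0 <= k (t0 - s) by exact: kpow_ge0.
have [sd|sd] := ltP s (t0 - d).
  by rewrite subr_gt0 sd mulr1 subrr normr0 !mulr_ge0 ?kpow_ge0.
rewrite subr_gt0 ltNge sd mulr0 mul0r subr0 normrM ger0_norm// kpow0.
rewrite (_ : (0 < _)%R = true) ?mulr1; last by lra.
by rewrite mulrC ler_wpM2r// ge//; lra.
Qed.

(** Here [D] and [T] stand for the powers [al] of [d] and [- al] of [t0]. The gain [c * T * D * p]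
    exceeds the tail error [2 * ka * b * e * D * p] by exactly [e * D * p], thanks to the [+ 1] in
    the equation for [e]. *)
Let balayage_arith (c ka b p D T e u j : R) :
  0 <= ka -> 0 <= b -> 0 < D -> 0 < p -> 0 < e ->
  - c * (b - D * T * p) <= ka * (b * j) ->
  - (e * (2 * D * p)) <= u - j -> e * (2 * (ka * b) + 1) = c * T ->
  0 < c + ka * u.
Proof.
move=> ka0 b0 D0 p0 e0 lo hi eE.
have h1 := ler_wpM2l (mulr_ge0 ka0 b0) hi.
have h2 : 0 < e * (D * p) by rewrite !mulr_gt0.
have h3 : e * (2 * (ka * b) + 1) * (D * p) = c * T * (D * p) by rewrite eE.
have : 0 < b * (c + ka * u) by lra.
by rewrite !ltNge; apply: contra => cu; rewrite mulr_ge0_le0.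
Qed.

(** Gain and tail error both scale as the power [al] of [d], so the tolerance [e] on [g] can be
    fixed first and [d] chosen from it. *)
Lemma frac_int_gt0 (c ka : R) : 0 < t0 -> 0 < c -> 0 <= ka ->
  (forall t : R, 0 <= t <= t0 -> 0 <= c + ka * Ig t) ->
  (forall e, 0 < e -> exists2 d, 0 < d & forall s, t0 - d < s -> `|g s| <= e) ->
  0 < c + ka * Ig t0.
Proof.
move=> t00 c0 ka0 u0 gcvg.
have ct : 0 < c * t0 `^ (- al) by rewrite mulr_gt0// powR_gt0.
pose N := 2 * (ka * B) + 1.
have N0 : 0 < N by rewrite /N ltr_wpDl// mulr_ge0// mulr_ge0.
pose e := c * t0 `^ (- al) / N.
have e0 : 0 < e by rewrite divr_gt0.
have [d' d'0 gd'] := gcvg _ e0.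
(* Halving gives both [2 * d <= d'], for the window of [frac_int_tail], and [d < t0]. *)
pose d := Num.min d' t0 / 2.
have m0 : 0 < Num.min d' t0 by rewrite lt_min d'0.
have d0 : 0 < d by rewrite divr_gt0.
have dt0 : d < t0.
  have : Num.min d' t0 <= t0 by rewrite ge_min lexx orbT.
  by rewrite /d; lra.
have gd s : t0 - d *+ 2 < s -> `|g s| <= e.
  move=> sd; apply: gd'; apply: le_lt_trans sd.
  have : Num.min d' t0 <= d' by rewrite ge_min lexx.
  by rewrite /d; lra.
have lo := frac_int_trunc_ge c0 d0 dt0 u0.
have := frac_int_tail d0 (ltW e0) gd.
rewrite -/(Ig t0) ler_norml => /andP[hi _].
move: lo hi; set J := \int[mu]_s _ => lo hi.
have pE : (d / t0) `^ al = d `^ al * t0 `^ (- al).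
  rewrite powRM ?invr_ge0 ?ltW// -[t0^-1](@powR_inv1 _ t0) ?ltW// -powRrM.
  by rewrite mulN1r.
rewrite pE in lo.
have da : 0 < d `^ al by rewrite powR_gt0.
have P0 : 0 < P by exact: lt_le_trans P1.
have eN : e * N = c * t0 `^ (- al) by rewrite /e divfK// gt_eqF.
exact: (balayage_arith ka0 B0 da P0 e0 lo hi eN).
Qed.

End positivity.

(** * First zero of a continuous function *)

Lemma within_continuous_dist (R : realType) (A : set R) (h : R -> R) (t e : R) :
  {within A, continuous h} -> A t -> 0 < e ->
  exists2 d, 0 < d & forall s, A s -> `|s - t| < d -> `|h s - h t| < e.
Proof.
move=> /subspace_continuousP hc At e0.
have /cvgrPdist_lt /(_ e e0) := hc t At.
rewrite /prop_near1 /within/= => -[d /= d0 hd].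
exists d => // s As st; rewrite distrC; apply: hd => //=.
by rewrite distrC.
Qed.

(** The witness is the infimum of the points with [u <= 0], not [u = 0]: positivity before it is
    then immediate, and continuity gives its value. *)
Lemma first_zero (R : realType) (u : R -> R) (t1 : R) :
  {within `[0, t1], continuous u} -> 0 <= t1 -> 0 < u 0 -> u t1 = 0 ->
  exists t0, [/\ 0 < t0, t0 <= t1, u t0 = 0 &
    forall t, 0 <= t -> t < t0 -> 0 < u t].
Proof.
move=> cu t1_ge0 u0 ut1.
have cd t e := @within_continuous_dist R `[0, t1] u t e cu.
pose S := [set t | 0 <= t <= t1 /\ u t <= 0].
have St1 : S t1 by split; rewrite ?ut1// t1_ge0 lexx.
have S0 : lbound S 0 by move=> t [/andP[]].
have hS : has_inf S by split; [exists t1|exists 0].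
have t0t1 : inf S <= t1 by apply: ge_inf => //; exists 0.
have t0_ge0 : 0 <= inf S by apply: lb_le_inf => //; exists t1.
have It0 : inf S \in `[0, t1] by rewrite in_itv/= t0_ge0.
have upos t : 0 <= t -> t < inf S -> 0 < u t.
  move=> t_ge0 tS; rewrite ltNge; apply/negP => ut.
  have : inf S <= t.
    apply: ge_inf; first by exists 0.
    by split=> //; rewrite t_ge0/= ltW// (lt_le_trans tS).
  by rewrite leNgt tS.
have ule : u (inf S) <= 0.
  rewrite leNgt; apply/negP => uS.
  have [d d0 hd] := cd _ _ It0 uS.
  have [s Ss sd] := inf_adherent d0 hS.
  have [/andP[s0 s1] us] := Ss.
  have Ss' : inf S <= s by apply: ge_inf => //; exists 0.
  have Is : s \in `[0, t1] by rewrite in_itv/= s0.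
  have sd' : `|s - inf S| < d by rewrite ger0_norm ?subr_ge0// ltrBlDl.
  by have := hd s Is sd'; rewrite ltr_norml => /andP[]; lra.
have S_gt0 : 0 < inf S.
  rewrite lt_neqAle t0_ge0 andbT; apply/eqP => S0E.
  by move: ule; rewrite -S0E leNgt u0.
have uge : 0 <= u (inf S).
  rewrite leNgt; apply/negP => uS.
  have uS' : 0 < - u (inf S) by rewrite oppr_gt0.
  have [d d0 hd] := cd _ _ It0 uS'.
  (* A point just before [inf S], kept in [[0, t1]] by the maximum, where [u] would be both positive
     and negative. *)
  pose s := Num.max 0 (inf S - d / 2).
  have s0 : 0 <= s by rewrite le_max lexx.
  have sS : s < inf S by rewrite gt_max S_gt0/=; lra.
  have sd : inf S - d / 2 <= s by rewrite le_max lexx orbT.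
  have us := upos s s0 sS.
  have Is : s \in `[0, t1] by rewrite in_itv/= s0 (le_trans (ltW sS)).
  have sd' : `|s - inf S| < d by rewrite ltr0_norm ?subr_lt0// opprB; lra.
  by have := hd s Is sd'; rewrite ltr_norml => /andP[]; lra.
by exists (inf S); split => //; apply/eqP; rewrite eq_le ule.
Qed.

(** * Comparison of two solutions *)

Lemma Gamma_ge0 (R : realType) (a : R) : 0 <= Gamma a.
Proof.
rewrite fine_ge0// integral_ge0// => t _.
by rewrite lee_fin mulr_ge0 ?powR_ge0 ?expR_ge0.
Qed.

Lemma solutions_neq (R : realType) (alpha : R) (T : \bar R)
    (f : R -> R -> R) (L x1 x2 : R -> R) :
  0 < alpha < 1 -> {within Jset T, continuous L} ->
  (forall t x y, Jset T t -> `|f t x - f t y| <= L t * `|x - y|) ->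
  is_solution alpha T f x1 -> is_solution alpha T f x2 ->
  x2 0 < x1 0 -> forall t, Jset T t -> x1 t <> x2 t.
Proof.
move=> al01 cL lip [c1 s1] [c2 s2] x0 t1 [t1_ge0 t1T] x12.
(* With a nonzero exponent [powR] sends 0 to 0, so [rl_integrand] agrees with the [kpow] kernel at
   [s = t]. *)
have a0 : alpha - 1 != 0 by case/andP: al01 => ? ?; rewrite lt_eqF//; lra.
pose u t := x1 t - x2 t.
have JI b : b <= t1 -> `[0, b] `<=` Jset T.
  move=> bt1 s; rewrite /= in_itv/= => /andP[s0 sb]; split => //.
  by rewrite (le_trans _ t1T)// lee_fin (le_trans sb).
have cu b : b <= t1 -> {within `[0, b], continuous u}.
  move=> bt1 s; apply: cvgB.
    exact: (continuous_subspaceW (JI b bt1) c1).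
  exact: (continuous_subspaceW (JI b bt1) c2).
have c0 : 0 < u 0 by rewrite subr_gt0.
have ut1 : u t1 = 0 by rewrite /u x12 subrr.
have [t0 [t0_gt0 t0t1 ut0 upos]] := first_zero (cu t1 (lexx _)) t1_ge0 c0 ut1.
have J0 s : 0 <= s -> s <= t0 -> Jset T s.
  by move=> s0 st; apply: (JI t0 t0t1); rewrite /= in_itv/= s0.
have uge s : 0 <= s -> s <= t0 -> 0 <= u s.
  move=> s0; rewrite le_eqVlt => /predU1P[->|st]; first by rewrite ut0.
  exact/ltW/upos.
have [cM _ Lmax] := EVT_max (ltW t0_gt0) (continuous_subspaceW (JI t0 t0t1) cL).
have [cu' cu'I umax] := EVT_max (ltW t0_gt0) (cu t0 t0t1).
pose ML := `|L cM|; pose Mu := u cu'.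
have ML0 : 0 <= ML by exact: normr_ge0.
have Mu0 : 0 <= Mu by move: cu'I; rewrite in_itv/= => /andP[]; exact: uge.
(* Extension by 0 to the whole line; integrals over [[0, t]] with [t <= t0] are unchanged. *)
pose g s := if (0 <= s) && (s < t0) then f s (x1 s) - f s (x2 s) else 0.
have gE s : 0 <= s -> s < t0 -> g s = f s (x1 s) - f s (x2 s).
  by rewrite /g => -> ->.
have g_lt0 s : s < 0 -> g s = 0 by rewrite /g leNgt => ->.
have g_ge s : t0 <= s -> g s = 0 by rewrite /g ltNge => ->; rewrite andbF.
have gu s : 0 <= s -> s < t0 -> `|g s| <= ML * u s.
  move=> s0 st; rewrite gE// (le_trans (lip _ _ _ (J0 s s0 (ltW st))))//.
  rewrite -/(u s) ger0_norm ?uge ?(ltW st)// ler_wpM2r ?uge ?(ltW st)//.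
  by rewrite (le_trans _ (ler_norm _))// Lmax// in_itv/= s0 ltW.
have gM s : `|g s| <= ML * Mu.
  have [s0|s0] := ltP s 0; first by rewrite g_lt0// normr0 mulr_ge0.
  have [st|st] := leP t0 s; first by rewrite g_ge// normr0 mulr_ge0.
  by rewrite (le_trans (gu s s0 st))// ler_wpM2l// umax// in_itv/= s0 ltW.
have gcvg e : 0 < e -> exists2 d, 0 < d & forall s, t0 - d < s -> `|g s| <= e.
  move=> e0; have ML1 : 0 < ML + 1 by rewrite ltr_wpDl.
  have It0 : t0 \in `[0, t0] by rewrite in_itv/= lexx ltW.
  (* The tolerance is [e / (ML + 1)] because [ML] may be 0. *)
  have [d d0 hd] := within_continuous_dist (cu t0 t0t1) It0 (divr_gt0 e0 ML1).
  exists d => // s sd.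
  have [s0|s0] := ltP s 0; first by rewrite g_lt0// normr0 ltW.
  have [st|st] := leP t0 s; first by rewrite g_ge// normr0 ltW.
  rewrite (le_trans (gu s s0 st))//.
  have Is : s \in `[0, t0] by rewrite in_itv/= s0 ltW.
  have sd' : `|s - t0| < d by rewrite ltr0_norm ?subr_lt0// opprB; lra.
  have := hd s Is sd'; rewrite ut0 subr0.
  rewrite ger0_norm ?uge ?(ltW st)// ltr_pdivlMr// => h.
  apply/ltW/(le_lt_trans _ h); rewrite mulrC ler_wpM2l ?uge ?(ltW st)//.
  by rewrite lerDl.
have [i1 _] := s1 t0 (J0 t0 (ltW t0_gt0) (lexx _)).
have [i2 _] := s2 t0 (J0 t0 (ltW t0_gt0) (lexx _)).
(* Measurability comes from the integrands at [t0]: the power [1 - alpha] of [t0 - s] cancels the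
   kernel, and both sides vanish at [s = t0]. *)
have mg : measurable_fun [set: R] g.
  rewrite (_ : g = (fun s => (rl_integrand alpha f x1 t0 s -
      rl_integrand alpha f x2 t0 s) * kpow (1 - alpha) (t0 - s)) \_ `[0, t0]).
    apply/measurable_restrict => //; rewrite setTI; apply: measurable_funM.
      apply: measurable_funB.
        by apply/measurable_EFinP; case/integrableP: i1.
      by apply/measurable_EFinP; case/integrableP: i2.
    by apply: measurable_funTS; exact: measurable_kpowB.
  apply/funext => s; rewrite patchE; case: ifPn.
    rewrite inE/= in_itv/= => /andP[s0]; rewrite le_eqVlt => /predU1P[->|st].
      by rewrite g_ge// subrr kpow_le0// mulr0.
    have ts : 0 < t0 - s by rewrite subr_gt0.
    rewrite gE// /rl_integrand kpow_gt0// -mulrBr mulrAC -powRD; last first.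
      by rewrite (gt_eqF ts) implybT.
    by rewrite addrA subrK subrr powRr0 mul1r.
  rewrite notin_setE/= in_itv/= => /negP; rewrite negb_and -!ltNge => /orP[|st].
    exact: g_lt0.
  by rewrite g_ge// ltW.
(* The difference of the two integral equations; on the whole line, [g] kills negative [s] and the
   truncated kernel kills [s > t]. *)
have uE t : 0 <= t -> t <= t0 -> u t = u 0 + (Gamma alpha)^-1 * frac_int alpha g t.
  move=> t_ge0 tt0.
  have [j1 e1] := s1 t (J0 t t_ge0 tt0); have [j2 e2] := s2 t (J0 t t_ge0 tt0).
  rewrite /u e1 e2 opprD addrACA -mulrBr -RintegralB//.
  congr (_ + _ * _); rewrite Rintegral_mkcond; apply: eq_Rintegral => s _.
  rewrite patchE; case: ifPn.
    rewrite inE/= in_itv/= => /andP[s0]; rewrite le_eqVlt => /predU1P[->|st].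
      by rewrite /rl_integrand subrr powR0// kpow_le0// !mul0r subrr.
    rewrite /rl_integrand -mulrBr kpow_gt0 ?subr_gt0// gE//.
    exact: lt_le_trans tt0.
  rewrite notin_setE/= in_itv/= => /negP; rewrite negb_and -!ltNge => /orP[s0|st].
    by rewrite g_lt0// mulr0.
  by rewrite kpow_le0 ?mul0r// subr_le0 ltW.
have ka0 : 0 <= (Gamma alpha)^-1 by rewrite invr_ge0 Gamma_ge0.
have upos' t : 0 <= t <= t0 -> 0 <= u 0 + (Gamma alpha)^-1 * frac_int alpha g t.
  by move=> /andP[t_ge0 tt0]; rewrite -uE// uge.
have := frac_int_gt0 al01 mg gM g_lt0 g_ge t0_gt0 c0 ka0 upos' gcvg.
by rewrite -uE ?lexx ?(ltW t0_gt0)// ut0 ltxx.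
Qed.

Theorem mainTheorem1 (R : realType) (alpha : R) (T : \bar R)
  (f : R -> R -> R) (L : R -> R) :
  0 < alpha < 1 ->
  (0 < T)%E ->
  {within [set p : R * R | Jset T p.1], continuous (fun p : R * R => f p.1 p.2)} ->
  {within Jset T, continuous L} ->
  (forall t, Jset T t -> 0 <= L t) ->
  (forall t x y, Jset T t -> `|f t x - f t y| <= L t * `|x - y|) ->
  forall x1 x2 : R -> R,
    is_solution alpha T f x1 -> is_solution alpha T f x2 ->
    x1 0 <> x2 0 ->
    forall t, Jset T t -> x1 t <> x2 t.
Proof.
move=> al01 _ _ cL _ lip x1 x2 s1 s2 /eqP; rewrite neq_lt => /orP[] x12 t Jt.
  by move=> /esym; exact: (solutions_neq al01 cL lip s2 s1 x12 Jt).
exact: (solutions_neq al01 cL lip s1 s2 x12 Jt).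
Qed.
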